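(* Let $n \ge 1$ be an integer, let $A=\{a_1,\ldots,a_n\}$ be a set of $n$ distinct symbols, and let $Q$ be a Latin square of order $n$ with symbols $a_1,\ldots,a_n$. Let $\cdot$ be the binary operation on $A$ whose multiplication table is $Q$, i.e. $a_i\cdot a_j$ is the entry of $Q$ in row $i$ and column $j$ for all $1\le i,j\le n$. If $\cdot$ is associative, i.e. $(x\cdot y)\cdot z = x\cdot (y\cdot z)$ for all $x,y,z\in A$, then $(A,\cdot)$ is a group (so $Q$ is the multiplication table of a group).
   Context: A Latin square of order $n$ with symbols $a_1,\ldots,a_n$ is an $n\times n$ table in which each row and each column is a permutation of these symbols (each symbol occurs exactly once in each row and exactly once in each column). Such a table is regarded as the multiplication table of a binary operation on $A=\{a_1,\ldots,a_n\}$, with the $i$-th row and the $i$-th column both indexed by $a_i$. The Latin square is called associative if the corresponding binary operation is associative. *)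

(* Defs.v *)
From mathcomp Require Import all_boot all_algebra all_fingroup.

Set Implicit Arguments.
Unset Strict Implicit.
Unset Printing Implicit Defensive.

Definition latin_square (A : Type) (n : nat) (a : 'I_n -> A) (Q : 'M[A]_n) : Prop :=
  (forall i : 'I_n, exists s : 'S_n, forall j : 'I_n, Q i j = a (s j)) /\
  (forall j : 'I_n, exists s : 'S_n, forall i : 'I_n, Q i j = a (s i)).

Definition mul_table (A : Type) (n : nat) (a : 'I_n -> A) (Q : 'M[A]_n)
    (op : A -> A -> A) : Prop :=
  forall i j : 'I_n, op (a i) (a j) = Q i j.

(* [G] is a [groupType] structure on the carrier [A] itself (the name
   [Group] alone would denote the subgroup constructor of fingroup). *)
Definition is_group (A : Type) (op : A -> A -> A) : Prop :=
  exists G : monoid.Group.axioms_ A,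
    @monoid.mul (monoid.Group.Pack G) = op.

(* Main.v *)
Require Import Defs.
From HB Require Import structures.
From mathcomp Require Import all_boot all_algebra all_fingroup.

(** Every row and column of a Latin square contains every symbol, so both
    equations [op x u = y] and [op u x = y] are solvable, for all [x] and [y].
    By Huntington's criterion, a nonempty semigroup with this property is a
    group ([divisible_semigroup_is_group]). An element that fixes one [x0] from
    the left fixes every [y], because [y = op x0 u] for some [u]; hence there is
    a left identity, symmetrically a right one, and the two coincide. The
    solutions of [op z x = e] and [op x z = e] are then one-sided inverses of
    [x], which coincide by associativity. *)

(** Huntington's criterion. A [groupType] carries an inversion function, while
    the hypotheses only assert that solutions exist; this is why the carrier has
    a choice operator, which selects one left inverse of each element. *)
Lemma divisible_semigroup_is_group (A : choiceType) (op : A -> A -> A) (x0 : A) :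
    associative op ->
    (forall x y, exists u, op x u = y) ->
    (forall x y, exists u, op u x = y) ->
  is_group op.
Proof.
move=> opA divl divr.
have [e ex0] := divr x0 x0; have [f x0f] := divl x0 x0.
have op1x : left_id e op by move=> x; have [u <-] := divl x0 x; rewrite opA ex0.
have opxf : right_id f op by move=> x; have [u <-] := divr x0 x; rewrite -opA x0f.
have opx1 : right_id e op by rewrite -(opxf e) op1x.
have exV x : exists z, op z x == e by have [z /eqP] := divr x e; exists z.
pose inv x := xchoose (exV x).
have opVx : left_inverse e inv op by move=> x; apply/eqP/(xchooseP (exV x)).
have opxV : right_inverse e inv op.
  move=> x; have [z xz] := divl x e.
  by rewrite -[inv x]opx1 -xz (opA (inv x)) opVx op1x.
pose groupA := @isGroup.Axioms_ A (Choice.class A) (Choice.class A) e inv op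
  opA op1x opx1 opVx opxV.
pose G : groupType := HB.pack (Choice.sort A) groupA.
by exists (monoid.Group.class G).
Qed.

Lemma latin_square_row_surj {A : Type} {n : nat} {a : 'I_n -> A} {Q : 'M[A]_n} :
  bijective a -> latin_square a Q -> forall i y, exists j, Q i j = y.
Proof.
move=> [b _ bK] [rowQ _] i y; have [s Qs] := rowQ i.
by exists (s^-1%g (b y)); rewrite Qs permKV bK.
Qed.

(** Transposition exchanges rows and columns, so that the solvability of
    [op u x = y] is the row statement for the transposed table. *)
Lemma latin_square_trmx {A : Type} {n : nat} {a : 'I_n -> A} {Q : 'M[A]_n} :
  latin_square a Q -> latin_square a Q^T.
Proof.
by move=> [rowQ colQ]; split=> k; [have [s Qs] := colQ k | have [s Qs] := rowQ k];
  exists s => l; rewrite mxE.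
Qed.

Theorem theorem2p1 (n : nat) (hn : (1 <= n)%N)
  (A : finType) (a : 'I_n -> A) (ha : bijective a)
  (Q : 'M[A]_n) (hQ : latin_square a Q)
  (op : A -> A -> A) (hop : mul_table a Q op)
  (hassoc : forall x y z : A, op (op x y) z = op x (op y z)) :
  is_group op.
Proof.
have [b _ bK] := ha.
apply: (divisible_semigroup_is_group _ _ (a (Ordinal hn))) => [x y z|x y|x y].
- by rewrite hassoc.
- have [j Qj] := latin_square_row_surj ha hQ (b x) y.
  by exists (a j); rewrite -(bK x) hop.
- have [i Qi] := latin_square_row_surj ha (latin_square_trmx hQ) (b x) y.
  by exists (a i); rewrite -(bK x) hop -Qi mxE.
Qed.
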